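(* Let $\tau$ be a vocabulary containing constants $0,\max$ and a binary relation symbol $S$ (the successor relation), and let $R\notin\tau$ be a $k$-ary relation symbol. Then for every $\tau\cup\{R\}$-sentence $\psi$ of $\mathrm{SO}\exists\text{-Horn}$ in which $R$ appears only negatively, there is a $\tau$-formula $\varphi$ of $\mathrm{BD}\text{-Horn}$ with free variables $z_1,\dots,z_k$ such that for all $\tau$-structures $\mathfrak A$ and all teams $X\neq\emptyset$ with domain $\{z_1,\dots,z_k\}$: $\mathfrak A\models_X\varphi$ iff $(\mathfrak A,\mathrm{rel}(X))\models\psi$.
   Context: Team semantics: a team $X$ is a set of assignments into $A$ with a common domain; for domain $\{z_1,\dots,z_k\}$, $\mathrm{rel}(X)=\{(s(z_1),\dots,s(z_k)):s\in X\}$. $\mathfrak A\models_X$ a first-order literal iff all $s\in X$ satisfy it; $\mathfrak A\models_X=\!(t_1,\dots,t_n)$ iff any $s,s'\in X$ agreeing on $t_1,\dots,t_{n-1}$ agree on $t_n$; $\mathfrak A\models_X\neg=\!(\dots)$ iff $X=\emptyset$; $\wedge$ componentwise; $\mathfrak A\models_X\chi_1\vee\chi_2$ iff $X=Y\cup Z$ with $\mathfrak A\models_Y\chi_1$, $\mathfrak A\models_Z\chi_2$; $\mathfrak A\models_X\exists x\chi$ iff $\mathfrak A\models_{\{s(F(s)/x):s\in X\}}\chi$ for some $F:X\to A$; $\mathfrak A\models_X\forall x\chi$ iff $\mathfrak A\models_{\{s(a/x):s\in X,a\in A\}}\chi$. A clause is a disjunction of atomic and negated atomic first-order formulae (including $\bot,\top$).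 A $\mathrm{BD}\text{-Horn}$ formula is $\forall\overline x\exists y_1\dots\exists y_n(\bigwedge_i=\!(\overline w_i,y_i)\wedge\bigwedge_jC_j)$ with $y_i$ pairwise distinct, clauses $C_j$ each containing at most one positive atomic formula with an occurrence of an existentially quantified variable, and existentially quantified variables occurring only in atoms $y_i=0$ or $y_i=y_j$ (free variables may occur). An $\mathrm{SO}\exists\text{-Horn}$ sentence is $\exists P_1\dots\exists P_m\forall\overline x\bigwedge_jC_j$ with each clause $C_j$ containing at most one positive occurrence of a quantified predicate $P_i$; $R$ appears only negatively if every occurrence of $R$ is in a negated atom. *)

(* Defs.v *)
(* MathComp with the classical sets of MathComp-Analysis *)
From mathcomp Require Import all_boot.
From mathcomp Require Import boolp classical_sets.
From Stdlib Require List.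

Set Implicit Arguments.
Unset Strict Implicit.
Unset Printing Implicit Defensive.

Local Open Scope classical_set_scope.

Notation var := nat (only parsing).

(** * Vocabularies and structures *)

(* Constants and function symbols are kept apart from the relation symbols:
   adding relation symbols then leaves the type of terms and the interpretation
   of terms unchanged. *)
Record signature := Signature {
  csym : Type;
  fsym : Type;
  far : fsym -> nat }.

Record vocabulary := Vocabulary {
  voc_sig :> signature;
  rsym : Type;
  rar : rsym -> nat }.

(* Only the symbols are fixed here; a structure may interpret [zero], [max] and
   [succ] arbitrarily. *)
Record succ_vocabulary := SuccVocabulary {
  succ_voc :> vocabulary;
  zero : csym succ_voc;
  max : csym succ_voc;
  succ : rsym succ_voc;
  succ_binary : rar succ = 2 }.

(* The relation symbols of [extend t ar] are those of [t] together with new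
   symbols indexed by [I]; since the union is disjoint, the new symbols do not
   belong to [t]. *)
Definition extend (t : vocabulary) (I : Type) (ar : I -> nat) : vocabulary :=
  {| voc_sig := t; rsym := (rsym t + I)%type;
     rar := fun r => match r with inl r => rar r | inr i => ar i end |}.

Definition add_rel (t : vocabulary) (k : nat) : vocabulary :=
  extend t (fun _ : unit => k).

Record algebra (sg : signature) := Algebra {
  carrier :> Type;
  ic : csym sg -> carrier;
  ifun : forall f : fsym sg, ('I_(far f) -> carrier) -> carrier }.

Record structure (t : vocabulary) := Structure {
  str_alg :> algebra t;
  irel : forall r : rsym t, set ('I_(rar r) -> str_alg) }.

Definition expand (t : vocabulary) (I : Type) (ar : I -> nat) (A : structure t)
    (P : forall i : I, set ('I_(ar i) -> A)) : structure (extend t ar) :=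
  @Structure (extend t ar) A
    (fun r => match r with inl r => @irel t A r | inr i => P i end).

Definition expand_rel (t : vocabulary) (k : nat) (A : structure t)
    (Q : set ('I_k -> A)) : structure (add_rel t k) :=
  expand (ar := fun _ : unit => k) (fun _ => Q).

(** * Terms, literals, clauses *)

Inductive term (sg : signature) :=
| Var (x : var)
| Const (c : csym sg)
| App (f : fsym sg) (args : 'I_(far f) -> term sg).
Arguments Var {sg} x.

Fixpoint tvars (sg : signature) (u : term sg) : seq var :=
  match u with
  | Var x => [:: x]
  | Const _ => [::]
  | App f g => flatten [seq tvars (g i) | i <- enum 'I_(far f)]
  end.

Fixpoint teval (sg : signature) (A : algebra sg) (s : var -> A) (u : term sg)
    : A :=
  match u with
  | Var x => s x
  | Const c => @ic sg A c
  | App f g => @ifun sg A f (fun i => teval s (g i))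
  end.

Inductive atom (t : vocabulary) :=
| Bot
| Top
| Eq (u v : term t)
| Rel (r : rsym t) (args : 'I_(rar r) -> term t).
Arguments Bot {t}.
Arguments Top {t}.
Arguments Eq {t} u v.

Definition avars (t : vocabulary) (a : atom t) : seq var :=
  match a with
  | Bot | Top => [::]
  | Eq u v => tvars u ++ tvars v
  | Rel r g => flatten [seq tvars (g i) | i <- enum 'I_(rar r)]
  end.

Definition aholds (t : vocabulary) (A : structure t) (s : var -> A)
    (a : atom t) : Prop :=
  match a with
  | Bot => False
  | Top => True
  | Eq u v => teval s u = teval s v
  | Rel r g => @irel t A r (fun i => teval s (g i))
  end.

Inductive literal (t : vocabulary) := Pos (a : atom t) | Neg (a : atom t).

Definition latom (t : vocabulary) (l : literal t) : atom t :=
  match l with Pos a | Neg a => a end.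

Definition lholds (t : vocabulary) (A : structure t) (s : var -> A)
    (l : literal t) : Prop :=
  match l with Pos a => aholds s a | Neg a => ~ aholds s a end.

Definition clause (t : vocabulary) := seq (literal t).

Definition cvars (t : vocabulary) (C : clause t) : seq var :=
  flatten [seq avars (latom l) | l <- C].

Definition cholds (t : vocabulary) (A : structure t) (s : var -> A)
    (C : clause t) : Prop :=
  List.Exists (lholds s) C.

(** * Dependence logic with team semantics *)

Inductive form (t : vocabulary) :=
| Lit (l : literal t)
| Dep (us : seq (term t)) (u : term t)    (* =(us, u) *)
| NDep (us : seq (term t)) (u : term t)   (* ~ =(us, u) *)
| And (p q : form t)
| Or (p q : form t)
| Ex (x : var) (p : form t)
| All (x : var) (p : form t).
Arguments Ex {t} x p.
Arguments All {t} x p.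

Fixpoint fv (t : vocabulary) (p : form t) : seq var :=
  match p with
  | Lit l => avars (latom l)
  | Dep us u | NDep us u => flatten [seq tvars v | v <- us] ++ tvars u
  | And p q | Or p q => fv p ++ fv q
  | Ex x p | All x p => [seq y <- fv p | y != x]
  end.

(* An assignment is a partial function, so that a team has a domain. *)
Definition assignment (A : Type) := var -> option A.

Definition team (A : Type) := set (assignment A).

Definition team_dom (A : Type) (V : seq var) (X : team A) : Prop :=
  forall s, X s -> forall x : var, (s x : bool) = (x \in V).

Definition upd (A : Type) (s : assignment A) (x : var) (a : A)
    : assignment A :=
  fun y => if y == x then Some a else s y.

Definition team_rel (A : Type) (k : nat) (z : k.-tuple var) (X : team A)
    : set ('I_k -> A) :=
  [set a | exists2 s, X s & forall i, s (tnth z i) = Some (a i)].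

(* The value given to a variable outside the domain of [s] is irrelevant for a
   formula whose free variables lie in the domain. *)
Definition total (t : succ_vocabulary) (A : structure t) (s : assignment A)
    : var -> A :=
  fun x => odflt (@ic t A (zero t)) (s x).

Fixpoint tsat (t : succ_vocabulary) (A : structure t) (X : team A)
    (p : form t) : Prop :=
  match p with
  | Lit l => forall s, X s -> lholds (total s) l
  | Dep us u => forall s s', X s -> X s' ->
      map (teval (total s)) us = map (teval (total s')) us ->
      teval (total s) u = teval (total s') u
  | NDep us u => X = set0
  | And p q => tsat X p /\ tsat X q
  | Or p q => exists Y Z, [/\ X = Y `|` Z, tsat Y p & tsat Z q]
  | Ex x p => exists F : assignment A -> A,
      tsat [set upd s x (F s) | s in X] p
  | All x p => tsat [set s' | exists2 s, X s & exists a, s' = upd s x a] p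
  end.

(** * BD-Horn formulae *)

Definition conj (t : vocabulary) (ps : seq (form t)) : form t :=
  foldr (@And t) (Lit (Pos Top)) ps.

Definition form_of_clause (t : vocabulary) (C : clause t) : form t :=
  foldr (@Or t) (Lit (Pos Bot)) (map (@Lit t) C).

Definition has_var_in (t : vocabulary) (ys : seq var) (a : atom t) : bool :=
  has (fun x => x \in ys) (avars a).

Definition pos_with_var_in (t : vocabulary) (ys : seq var) (l : literal t)
    : bool :=
  if l is Pos a then has_var_in ys a else false.

Definition bd_atom (t : succ_vocabulary) (ys : seq var) (a : atom t) : Prop :=
  has_var_in ys a ->
  (exists2 y, y \in ys & a = Eq (Var y) (@Const t (zero t))) \/
  (exists y y', [/\ y \in ys, y' \in ys & a = Eq (Var y) (Var y')]).

(* [deps] lists the pairs (w_i, y_i), in the order of the quantifiers on the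
   y_i. The side conditions say that the y_i occur nowhere except as the last
   entry of their own dependence atom and in atoms y_i = 0 or y_i = y_j. *)
Definition bd_horn (t : succ_vocabulary) (p : form t) : Prop :=
  exists (xs : seq var) (deps : seq (seq var * var)) (Cs : seq (clause t)),
    let ys := unzip2 deps in
    p = foldr All
          (foldr Ex
             (And (conj [seq @Dep t (map Var d.1) (Var d.2) | d <- deps])
                  (conj (map (@form_of_clause t) Cs)))
             ys)
          xs /\
    [/\ uniq ys,
        ~~ has (fun y => y \in xs) ys,
        all (fun d => ~~ has (fun w => w \in ys) d.1) deps,
        all (fun C => count (pos_with_var_in ys) C <= 1) Cs
      & List.Forall (List.Forall (fun l => bd_atom ys (latom l))) Cs].

(** * Existential second-order Horn sentences *)

(* The sentence  exists P_0 ... P_(m-1), forall xs, /\ Cs  where P_i has arity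
   [eso_ar i]. *)
Record eso (t : vocabulary) := Eso {
  eso_m : nat;
  eso_ar : 'I_eso_m -> nat;
  eso_xs : seq var;
  eso_Cs : seq (clause (extend t eso_ar)) }.

Definition pos_quantified (t : vocabulary) (m : nat) (ar : 'I_m -> nat)
    (l : literal (extend t ar)) : bool :=
  if l is Pos (Rel (inr _) _) then true else false.

Definition eso_horn_sentence (t : vocabulary) (p : eso t) : bool :=
  all (fun C => all (fun x => x \in eso_xs p) (cvars C)) (eso_Cs p) &&
  all (fun C => count (@pos_quantified t _ (@eso_ar t p)) C <= 1) (eso_Cs p).

(* All variables are bound by the universal prefix of a sentence, so its
   quantifiers amount to one quantification over all assignments. *)
Definition eso_holds (t : vocabulary) (A : structure t) (p : eso t) : Prop :=
  exists P : forall i, set ('I_(@eso_ar t p i) -> A),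
  forall s : var -> A,
    List.Forall (@cholds _ (expand P) s) (eso_Cs p).

Definition pos_added (t : vocabulary) (k m : nat) (ar : 'I_m -> nat)
    (l : literal (extend (add_rel t k) ar)) : bool :=
  if l is Pos (Rel (inl (inr _)) _) then true else false.

Definition only_negative (t : vocabulary) (k : nat) (p : eso (add_rel t k))
    : bool :=
  all (fun C => ~~ has (@pos_added t k _ (@eso_ar _ p)) C) (eso_Cs p).

(* Main.v *)
(* In BD-Horn, y = 0 encodes membership of the values of w in a predicate P,
   where y is a function of w alone; Horn clauses on the P_i become Horn clauses on
   such atoms. Several atoms of P in one clause need several copies of y, forced
   to agree by clauses [w <> w' \/ y = y']. The relation R is replaced by one
   more quantified predicate R', bounded below by the clause [w <> z \/ R' w];
   as R occurs only negatively, R' may as well be larger than R.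

   Nothing forces a structure to have two elements, and with one element every
   y = 0 is true. So the clauses above get the extra literal u = v with fresh
   universal u and v, and other clauses, with the extra literal y <> 0 for an
   otherwise unconstrained y, express the sentence in one-element structures:
   there it is a Boolean combination of closed atoms. *)
Require Import Defs.
From mathcomp Require Import all_boot.
From mathcomp Require Import boolp classical_sets.
From Stdlib Require List.

Set Implicit Arguments.
Unset Strict Implicit.
Unset Printing Implicit Defensive.

Local Open Scope classical_set_scope.

Local Notation total := Defs.total.
Local Notation zero := Defs.zero.

(** * Membership in lists and counting *)

Lemma Exists_In (T : Type) (P : T -> Prop) (s : seq T) :
  List.Exists P s <-> exists2 x, List.In x s & P x.
Proof.
rewrite List.Exists_exists; split=> [[x [? ?]]|[x ? ?]]; by exists x.
Qed.

Lemma all_In (T : Type) (a : pred T) (s : seq T) :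
  all a s <-> forall x, List.In x s -> a x.
Proof.
elim: s => [|y s IH] /=; first by [].
split=> [/andP[ay /IH as_] x [<-|/as_]//|H].
by apply/andP; split; [apply: H; left|apply/IH => x xs; apply: H; right].
Qed.

Lemma In_mem (T : eqType) (x : T) (s : seq T) : List.In x s <-> x \in s.
Proof.
elim: s => [|y s IH] //=; rewrite inE.
split=> [[->|/IH ->]|/orP[/eqP->|/IH]]; rewrite ?eqxx ?orbT; by [|left|right].
Qed.

Lemma In_cat (T : Type) (x : T) (s1 s2 : seq T) :
  List.In x (s1 ++ s2) <-> List.In x s1 \/ List.In x s2.
Proof. exact: List.in_app_iff. Qed.

Lemma In_map (T U : Type) (f : T -> U) (y : U) (s : seq T) :
  List.In y (map f s) <-> exists2 x, List.In x s & y = f x.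
Proof.
split=> [/List.in_map_iff[x [<- ?]]|[x ? ->]]; first by exists x.
by apply: List.in_map.
Qed.

Lemma In_flatten (T : Type) (x : T) (ss : seq (seq T)) :
  List.In x (flatten ss) <-> exists2 s, List.In s ss & List.In x s.
Proof.
elim: ss => [|s ss IH] /=; first by split=> // -[].
rewrite In_cat IH; split=> [[?|[s' ? ?]]|[s' [<-|?] ?]].
- by exists s; [left|].
- by exists s'; [right|].
- by left.
- by right; exists s'.
Qed.

(** Carries the Horn condition over to clauses assembled from blocks, one block for each source
    item. *)
Lemma count_flatten_le (T U : Type) (a : pred T) (b : pred U)
    (f : U -> seq T) (s : seq U) :
  (forall x, List.In x s -> count a (f x) <= b x) ->
  count a (flatten (map f s)) <= count b s.
Proof.
elim: s => [|x s IH] //= H; rewrite count_cat leq_add //; first by apply: H; left.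
by apply: IH => y ys; apply: H; right.
Qed.

(** * Evaluation depends only on the variables that occur *)

Section Locality.
Variables (t : vocabulary) (A : structure t).

Lemma teval_ext (e e' : var -> A) (u : term t) :
  (forall x, x \in tvars u -> e x = e' x) -> teval e u = teval e' u.
Proof.
elim: u => [x|c|f g IH] //= H; first by apply: H; rewrite inE.
congr ifun; apply: funext => i; apply: IH => x xi; apply: H.
by apply/flatten_mapP; exists i => //; rewrite mem_enum.
Qed.

Lemma aholds_ext (e e' : var -> A) (a : atom t) :
  (forall x, x \in avars a -> e x = e' x) -> aholds e a = aholds e' a.
Proof.
case: a => [| |u v|r g] //= H.
  by congr (_ = _); apply: teval_ext => x xi; apply: H; rewrite mem_cat xi ?orbT.
congr irel; apply: funext => i; apply: teval_ext => x xi; apply: H.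
by apply/flatten_mapP; exists i => //; rewrite mem_enum.
Qed.

Lemma lholds_ext (e e' : var -> A) (l : literal t) :
  (forall x, x \in avars (latom l) -> e x = e' x) -> lholds e l = lholds e' l.
Proof. by case: l => a /= /aholds_ext ->. Qed.

Lemma cholds_ext (e e' : var -> A) (C : clause t) :
  (forall x, x \in cvars C -> e x = e' x) -> cholds e C -> cholds e' C.
Proof.
move=> H /Exists_In[l lC lh]; apply/Exists_In; exists l => //.
rewrite -(lholds_ext (e := e)) // => x xl; apply: H.
elim: C lC => [|l' C IH] //=; rewrite /cvars /= mem_cat.
by case=> [->|/IH ->]; rewrite ?xl ?orbT.
Qed.

End Locality.

(** * Skolem semantics of BD-Horn formulae *)

Section TeamSemantics.
Variables (t : succ_vocabulary) (A : structure t).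
Implicit Types (X : team A) (s : assignment A) (e : var -> A).

(** Clauses are flat, having no dependence atoms: at each disjunction the team splits into the
    assignments satisfying the first literal and those satisfying the rest, where an overlap is
    allowed. *)
Lemma tsat_clause X (C : clause t) :
  tsat X (form_of_clause C) <-> forall s, X s -> cholds (total s) C.
Proof.
elim: C X => [|l C IH] X /=.
  by split=> [H s /H //|H s /H /Exists_In[]].
split=> [[Y [Z [-> HY /IH HZ]]] s [/HY|/HZ] h|H].
- exact: List.Exists_cons_hd.
- exact: List.Exists_cons_tl.
exists [set s | X s /\ lholds (total s) l], [set s | X s /\ cholds (total s) C].
split.
- apply/seteqP; split=> [s Xs|s [] [] //].
  by case/List.Exists_cons: (H s Xs) => h; [left|right].
- by move=> s [].
- by apply/IH => s [].
Qed.

Lemma tsat_conj X (ps : seq (form t)) :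
  tsat X (conj ps) <-> forall p, List.In p ps -> tsat X p.
Proof.
elim: ps => [|p ps IH] /=; first by split=> // _ s _.
rewrite IH; split=> [[Hp H] q [<-|/H]//|H].
by split=> [|q qs]; apply: H; [left|right].
Qed.

Definition override s (xs : seq var) e : assignment A :=
  fun x => if x \in xs then Some (e x) else s x.

Definition generalize X (xs : seq var) : team A :=
  [set s' | exists2 s, X s & exists e, s' = override s xs e].

(** Repetitions in [xs] are harmless: the innermost quantifier on a variable overwrites the outer
    ones, and [override] assigns one value per variable. *)
Lemma tsat_All X xs (p : form t) :
  tsat X (foldr All p xs) <-> tsat (generalize X xs) p.
Proof.
elim: xs X => [|x xs IH] X /=.
  suff -> : generalize X [::] = X by [].
  apply/seteqP; split=> [_ [s Xs [e ->]] //|s Xs].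
  by exists s => //; exists (fun=> @ic t A (zero t)).
rewrite IH; set T := generalize _ _; suff -> : T = generalize X (x :: xs) by [].
apply/seteqP; split=> [_ [_ [s Xs [a ->]] [e ->]]|_ [s Xs [e ->]]].
  exists s => //; exists (fun y => if y \in xs then e y else a).
  apply: funext => y; rewrite /override /upd inE.
  by case: (y \in xs); rewrite ?orbT ?orbF.
exists (upd s x (e x)); first by exists s => //; exists (e x).
exists e; apply: funext => y; rewrite /override /upd inE.
by case: (y \in xs); case: eqVneq => // ->.
Qed.

(* Without the disjointness from the domain of the team, the values of later
   variables could not depend on the overwritten values. *)
Lemma tsat_Ex X ys (p : form t) :
  uniq ys -> (forall s y, X s -> y \in ys -> s y = None) ->
  tsat X (foldr Ex p ys) <->
  exists G : assignment A -> var -> A,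
    tsat [set override s ys (G s) | s in X] p.
Proof.
elim: ys X => [|y ys IH] X /=.
  move=> _ _; have E G : [set override s [::] (G s) | s in X] = X.
    by apply/seteqP; split=> [_ [s Xs <-] //|s Xs]; exists s.
  split=> [H|[G]]; last by rewrite E.
  by exists (fun _ _ => @ic t A (zero t)); rewrite E.
move=> /andP[y_ys ys_uniq] XN.
have dom F s x : [set upd s y (F s) | s in X] s -> x \in ys -> s x = None.
  move=> [s0 Xs <-] xys; rewrite /upd; case: eqVneq => [xy|_].
    by rewrite -xy xys in y_ys.
  by apply: XN => //; rewrite inE xys orbT.
split=> [[F /(IH _ ys_uniq (@dom F))[G H]]|[G H]].
  exists (fun s x => if x \in ys then G (upd s y (F s)) x else F s).
  congr tsat: H; apply/seteqP; split=> [_ [_ [s Xs <-] <-]|_ [s Xs <-]].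
    exists s => //; apply: funext => x; rewrite /override /upd inE.
    by case: (x \in ys); rewrite ?orbT ?orbF.
  exists (upd s y (F s)); first by exists s.
  apply: funext => x; rewrite /override /upd inE.
  by case: (x \in ys); rewrite ?orbT ?orbF.
(* As [y] is outside the domain, erasing it recovers the original assignment, so Skolem functions of
   the latter can be read as functions of the updated one. *)
pose erase s : assignment A := fun x => if x == y then None else s x.
have eraseK s a : X s -> erase (upd s y a) = s.
  move=> Xs; apply: funext => x; rewrite /erase /upd.
  by case: eqVneq => // ->; rewrite XN ?inE ?eqxx.
exists (fun s => G s y); apply/(IH _ ys_uniq (@dom _)).
exists (fun s => G (erase s)).
congr tsat: H; apply/seteqP; split=> [_ [s Xs <-]|_ [_ [s Xs <-] <-]].
  exists (upd s y (G s y)); first by exists s.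
  apply: funext => x; rewrite eraseK // /override /upd inE.
  by case: (x \in ys); case: eqVneq => // ->.
exists s => //; apply: funext => x; rewrite eraseK // /override /upd inE.
by case: (x \in ys); case: eqVneq => // ->.
Qed.

End TeamSemantics.

(** * Closing a matrix under quantifiers, and its Skolem form *)

Section Closure.
Variables (t : succ_vocabulary) (z : seq var).
Variables (deps : seq (seq var * var)) (Cs : seq (clause t)).
Let ys := unzip2 deps.

Definition bd_matrix : form t :=
  And (conj [seq @Dep t (map Var d.1) (Var d.2) | d <- deps])
      (conj (map (@form_of_clause t) Cs)).

(** Binding every remaining variable leaves only those of [z] free. The list may contain
    repetitions. *)
Definition bd_bound : seq var :=
  [seq x <- fv bd_matrix | (x \notin z) && (x \notin ys)].

Definition bd_closure : form t := foldr All (foldr Ex bd_matrix ys) bd_bound.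

Lemma fv_All xs (p : form t) :
  fv (foldr All p xs) = [seq x <- fv p | x \notin xs].
Proof.
elim: xs => [|x xs IH] /=; first by rewrite filter_predT.
rewrite IH -filter_predI; apply: eq_filter => y /=.
by rewrite inE negb_or.
Qed.

Lemma fv_Ex xs (p : form t) :
  fv (foldr Ex p xs) = [seq x <- fv p | x \notin xs].
Proof.
elim: xs => [|x xs IH] /=; first by rewrite filter_predT.
rewrite IH -filter_predI; apply: eq_filter => y /=.
by rewrite inE negb_or.
Qed.

Lemma fv_conj (ps : seq (form t)) x :
  x \in fv (conj ps) <-> exists2 p, List.In p ps & x \in fv p.
Proof.
elim: ps => [|p ps IH] /=; first by split=> // -[].
rewrite mem_cat; split=> [/orP[xp|/IH[q qs xq]]|[q [<-|qs] xq]].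
- by exists p => //; left.
- by exists q => //; right.
- by rewrite xq.
- by apply/orP; right; apply/IH; exists q.
Qed.

Lemma fv_clause (C : clause t) : fv (form_of_clause C) = cvars C.
Proof. by elim: C => //= l C ->. Qed.

Lemma mem_fv_matrix_dep d x :
  d \in deps -> (x == d.2) || (x \in d.1) -> x \in fv bd_matrix.
Proof.
move=> dd xd; rewrite mem_cat; apply/orP; left; apply/fv_conj.
exists (@Dep t (map Var d.1) (Var d.2)); first by
  apply/In_map; exists d => //; exact/In_mem.
rewrite /= mem_cat inE; case/orP: xd => [->|xd]; first by rewrite orbT.
by apply/orP; left; rewrite -map_comp; apply/flatten_mapP; exists x => //; rewrite inE.
Qed.

Lemma mem_fv_matrix_clause C x :
  List.In C Cs -> x \in cvars C -> x \in fv bd_matrix.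
Proof.
move=> CCs xC; rewrite mem_cat; apply/orP; right; apply/fv_conj.
by exists (form_of_clause C); [apply/In_map; exists C|rewrite fv_clause].
Qed.

Hypothesis (ys_uniq : uniq ys) (ys_z : {in ys, forall y, y \notin z}).
Hypothesis deps_ys : {in deps, forall d, ~~ has (fun w => w \in ys) d.1}.

Lemma bd_horn_closure :
  (forall C, List.In C Cs -> count (pos_with_var_in ys) C <= 1) ->
  (forall C l, List.In C Cs -> List.In l C -> bd_atom ys (latom l)) ->
  bd_horn bd_closure.
Proof.
move=> cnt at_; exists bd_bound, deps, Cs; split=> //; split=> //.
- by apply/hasPn => y yys; rewrite mem_filter yys /= andbF.
- exact/allP.
- exact/all_In.
- by apply/List.Forall_forall => C CCs; apply/List.Forall_forall => l; exact: at_.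
Qed.

Lemma fv_closure : {subset z <= fv bd_matrix} -> fv bd_closure =i z.
Proof.
move=> zfv x; rewrite fv_All fv_Ex mem_filter mem_filter /bd_bound mem_filter.
have [xz|xz] := boolP (x \in z); last first.
  by case: (x \in fv _); rewrite ?andbF //= !andbT; case: (x \in ys).
by rewrite zfv //= andbT; apply: contraTN xz => /ys_z.
Qed.

(** The dependence atom of [d] says that [d.2] is a function of [d.1] on the whole team. Hence one
    Skolem function [h d] serves all assignments in [X], and the existential variables need not
    otherwise refer to the team. *)
Lemma tsat_closure (A : structure t) (X : team A) :
  team_dom z X ->
  tsat X bd_closure <->
  exists h : seq var * var -> seq A -> A,
  forall (s : assignment A) (e : var -> A), X s ->
    {in z, forall x, e x = total s x} ->
    {in deps, forall d, e d.2 = h d (map e d.1)} ->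
    forall C, List.In C Cs -> cholds e C.
Proof.
move=> Xz; rewrite tsat_All.
have dom s y : generalize X bd_bound s -> y \in ys -> s y = None.
  move=> [s0 Xs [e ->]] yys; rewrite /override mem_filter yys andbF /=.
  by have := Xz _ Xs y; rewrite (negbTE (ys_z yys)); case: (s0 y).
have dys d w : d \in deps -> w \in d.1 -> w \notin ys.
  by move=> /deps_ys /hasPn; apply.
have mem_ys d : d \in deps -> d.2 \in ys by move=> dd; apply: map_f.
rewrite tsat_Ex //; split=> [[G []]|[h H]].
  set T := image _ _ => /tsat_conj Hd /tsat_conj HC.
  (* [h] reads the value of [d.2] off the team; argument tuples realised by no member get a
     default. *)
  pose dep_value (d : seq var * var) (ws : seq A) (a : A) :=
    exists s, [/\ T s, map (total s) d.1 = ws & a = total s d.2].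
  pose h d ws : A :=
    if pselect (exists a, dep_value d ws a) is left ex then projT1 (cid ex)
    else @ic t A (zero t).
  exists h => s e Xs es ed C CCs.
  pose s1 := override s bd_bound e.
  pose s2 := override s1 ys (G s1).
  have Ts2 : T s2 by exists s1 => //; exists s => //; exists e.
  have e1 x : x \in fv bd_matrix -> x \notin ys -> total s2 x = e x.
    move=> xm xy; rewrite /total /s2 /override (negbTE xy) /s1 /override.
    rewrite mem_filter xm xy !andbT; case: ifPn => //; rewrite negbK.
    by move=> /es.
  have e2 x : x \in fv bd_matrix -> total s2 x = e x.
    move=> xm; have [|/e1 -> //] := boolP (x \in ys).
    move=> /mapP[d dd ->]; rewrite ed //.
    have E : map (total s2) d.1 = map e d.1.
      apply/eq_in_map => w wd; apply: e1; last exact: dys wd.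
      by apply: mem_fv_matrix_dep dd _; rewrite wd orbT.
    (* The arguments are realised by [s2] itself, so the default does not arise; the dependence atom
       then equates the value at [s2] with the chosen one. *)
    rewrite /h; case: pselect => [ex|[]]; last by exists (total s2 d.2), s2.
    case: (cid ex) => a /= [s' [Ts' E' aE]]; rewrite aE {aE}.
    have Hdep : tsat T (@Dep t (map Var d.1) (Var d.2)).
      by apply: Hd; apply/In_map; exists d => //; exact/In_mem.
    apply: (Hdep _ _ Ts2 Ts'); rewrite -!map_comp.
    by change (map (total s2) d.1 = map (total s') d.1); rewrite E'.
  have /tsat_clause /(_ _ Ts2) : tsat T (form_of_clause C).
    by apply: HC; apply/In_map; exists C.
  by apply: cholds_ext => x xC; apply: e2; apply: mem_fv_matrix_clause xC.
(* The entries of [ys] are distinct, so the index of [y] finds its dependence. No [w] lies in [ys],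
   so the arguments survive the overwriting of [ys]. *)
pose G (s : assignment A) y :=
  let d := nth ([::], 0) deps (index y ys) in h d (map (total s) d.1).
have GE s d : d \in deps -> G s d.2 = h d (map (total s) d.1).
  move=> dd; rewrite /G; suff -> : nth ([::], 0) deps (index d.2 ys) = d by [].
  rewrite -[in index _ _](nth_index ([::], 0) dd) -(nth_map _ 0) ?index_mem //.
  by rewrite index_uniq ?nth_index // size_map index_mem.
exists G; set T := image _ _.
have TE s : T s -> exists s0,
    [/\ X s0, {in z, forall x, total s x = total s0 x}
      & {in deps, forall d, total s d.2 = h d (map (total s) d.1)}].
  move=> [_ [s0 Xs [e ->]] <-]; exists s0; split=> // [x xz|d dd].
    rewrite /total /override mem_filter xz /=; case: ifP => // /ys_z.
    by rewrite xz.
  rewrite {1}/total /override mem_ys //= GE //; congr h.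
  by apply/eq_in_map => w wd; rewrite /total (negbTE (dys _ _ dd wd)).
split; apply/tsat_conj => p /In_map[].
  move=> d /In_mem dd -> s s' /TE[? [_ _ E]] /TE[? [_ _ E']] /=.
  rewrite -!map_comp /= E // E' // => eq; congr h; exact: eq.
move=> C CCs ->; apply/tsat_clause => s /TE[s0 [Xs Es Ed]].
exact: H Xs Es Ed C CCs.
Qed.

End Closure.

(** * The translation *)

Section Guarded.
Variables (t : vocabulary) (n : nat) (x : 'I_n -> var) (g : 'I_n -> term t).

(** The implication from all equations [x i = g i] to [l]. The guards are negative, so only [l] can
    count for the Horn condition. *)
Definition guarded (l : literal t) : clause t :=
  rcons [seq Neg (@Eq t (Var (x i)) (g i)) | i <- enum 'I_n] l.

Lemma In_guarded l l' :
  List.In l' (guarded l) ->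
  l' = l \/ exists i, l' = Neg (@Eq t (Var (x i)) (g i)).
Proof.
by rewrite /guarded -cats1 => /In_cat[/In_map[i _ ->]|[->|[]]]; [right; exists i|left].
Qed.

Lemma count_guarded ys l :
  count (pos_with_var_in ys) (guarded l) = pos_with_var_in ys l.
Proof. by rewrite /guarded -cats1 count_cat count_map /= addn0 count_pred0. Qed.

Lemma cvars_guarded i l : {subset tvars (g i) <= cvars (guarded l)}.
Proof.
move=> y yi; rewrite /cvars /guarded -cats1 map_cat flatten_cat mem_cat -map_comp.
apply/orP; left; apply/flatten_mapP; exists i; rewrite ?mem_enum //=.
by rewrite inE yi orbT.
Qed.

Lemma cholds_guarded (A : structure t) (e : var -> A) l :
  cholds e (guarded l) <->
  ((forall i, e (x i) = teval e (g i)) -> lholds e l).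
Proof.
rewrite /cholds Exists_In /guarded -cats1; split.
  move=> [l' /In_cat[/In_map[i _ ->] /= ne H|[<-|[]] //]].
  by case: ne; rewrite H.
move=> H; case: (EM (forall i, e (x i) = teval e (g i))) => [/H hl|].
  by exists l => //; apply/In_cat; right; left.
move=> /existsNP[i ne]; exists (Neg (@Eq t (Var (x i)) (g i))) => //.
by apply/In_cat; left; apply/In_map; exists i => //; apply/In_mem; rewrite mem_enum.
Qed.

End Guarded.

Section Translation.
Variables (t : succ_vocabulary) (k : nat) (z : k.-tuple nat).
Variables (m : nat) (ar : 'I_m -> nat).

Local Notation voc := (extend (add_rel t k) ar).

(* [None] stands for an existentially quantified superset of [R]. *)
Definition arity (i : option 'I_m) : nat := if i is Some j then ar j else k.

(* The variables of the translation: those of the given sentence; the arguments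
   of the predicates at a position of a clause; the values of the
   characteristic functions there; and three variables used to tell apart the
   structures with one element. *)
Definition bvar : Type :=
  (nat + (nat * nat) + (option 'I_m * nat) + option bool)%type.

(* Opaque, since unification would otherwise compute codes of open terms. *)
Lemma encoding : {enc : bvar -> var & {dec : var -> option bvar |
  (forall b, dec (enc b) = Some b) /\ forall b, enc b \notin z}}.
Proof.
pose offset := (\max_(x <- z) x).+1.
exists (fun b => offset + pickle b), (fun x => unpickle (x - offset)).
split=> b; first by rewrite addKn pickleK.
apply/negP => bz; have := @leq_bigmax_seq _ z xpredT id _ bz erefl.
by rewrite leqNgt /offset addSn ltnS leq_addr.
Qed.

Definition enc : bvar -> var := projT1 encoding.
Definition dec : var -> option bvar := sval (projT2 encoding).

Definition vX (x : nat) : var := enc (inl (inl (inl x))).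
Definition vW (p l : nat) : var := enc (inl (inl (inr (p, l)))).
Definition vY (i : option 'I_m) (p : nat) : var := enc (inl (inr (i, p))).
Definition vU : var := enc (inr (Some true)).
Definition vV : var := enc (inr (Some false)).
Definition vS : var := enc (inr None).

Lemma encK b : dec (enc b) = Some b.
Proof. exact: (svalP (projT2 encoding)).1. Qed.

Lemma enc_z b : enc b \notin z.
Proof. exact: (svalP (projT2 encoding)).2. Qed.

Lemma enc_inj : injective enc.
Proof. by move=> b c /(congr1 dec); rewrite !encK => -[]. Qed.

Fixpoint rename (u : term t) : term t :=
  match u with
  | Var x => Var (vX x)
  | Const c => @Const t c
  | App f g => @App t f (fun i => rename (g i))
  end.

Lemma tvars_rename u x : x \in tvars (rename u) -> exists y, x = vX y.
Proof.
elim: u => [y|c|f g IH] //=; first by rewrite inE => /eqP ->; exists y.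
by move=> /flatten_mapP[i _ /IH].
Qed.

Lemma teval_rename (A : structure t) (e : var -> A) u :
  teval e (rename u) = teval (fun x => e (vX x)) u.
Proof. by elim: u => //= f g IH; congr ifun; apply: funext. Qed.

Definition term0 : term t := @Const t (zero t).
Definition isZero (x : var) : atom t := @Eq t (Var x) term0.

(** A dependence lists variables, so the argument terms are first equated with the universal
    variables [vW p]. As these range over all values, the guard suits literals of either sign. *)
Definition tr_pred (sg : atom t -> literal t) i p (g : 'I_(arity i) -> term t)
    : clause t :=
  guarded (fun l => vW p l) (fun l => rename (g l)) (sg (isZero (vY i p))).

(** The inner match abstracts [g] because its type depends on the arity of [r]. *)
Definition tr_atom (sg : atom t -> literal t) (p : nat) (a : atom voc)
    : clause t :=
  match a with
  | Bot => [:: sg Bot]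
  | Top => [:: sg Top]
  | Eq u v => [:: sg (@Eq t (rename u) (rename v))]
  | Rel r g =>
    match r return ('I_(@rar voc r) -> term t) -> clause t with
    | inl (inl r) => fun g => [:: sg (@Rel t r (fun i => rename (g i)))]
    | inl (inr _) => fun g => @tr_pred sg None p g
    | inr i => fun g => @tr_pred sg (Some i) p g
    end g
  end.

Definition tr_lit (p : nat) (l : literal voc) : clause t :=
  match l with
  | Pos a => tr_atom (@Pos t) p a
  | Neg a => tr_atom (@Neg t) p a
  end.

Definition main_clause (C : clause voc) : clause t :=
  Pos (@Eq t (Var vU) (Var vV)) ::
  flatten [seq tr_lit p (nth (Pos Bot) C p) | p <- iota 0 (size C)].

Definition agree_clause (ip : option 'I_m * nat) : clause t :=
  guarded (fun l : 'I_(arity ip.1) => vW ip.2 l) (fun l => Var (vW 0 l))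
    (Pos (@Eq t (Var (vY ip.1 ip.2)) (Var (vY ip.1 0)))).

Definition rel_clause : clause t :=
  guarded (fun l : 'I_k => vW 0 l) (fun l => Var (tnth z l))
    (Pos (isZero (vY None 0))).

(* The value of a literal in a one-element structure where [R] is nonempty and
   [sg] lists the nonempty quantified predicates. *)
Definition bare_atom (sg : 'I_m -> bool) (a : atom voc) : atom t :=
  match a with
  | Bot => Bot
  | Top | Eq _ _ | Rel (inl (inr _)) _ => Top
  | Rel (inl (inl r)) _ => @Rel t r (fun _ => term0)
  | Rel (inr i) _ => if sg i then Top else Bot
  end.

Definition bare_lit sg (l : literal voc) : literal t :=
  match l with
  | Pos a => Pos (bare_atom sg a)
  | Neg a => Neg (bare_atom sg a)
  end.

Variable Cs : seq (clause voc).

Local Notation valuation := {ffun 'I_m -> bool}.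

(* These clauses are the distribution into conjunctive form of the disjunction
   of the given sentence over all valuations. Their first literal can be made
   true unless there is only one element. *)
Definition point_clause (f : {ffun valuation -> 'I_(size Cs)}) : clause t :=
  Neg (isZero vS) ::
  flatten [seq map (bare_lit sg) (nth [::] Cs (f sg)) | sg : valuation].

(** Exceeds every position in every clause; the successor ensures that slot 0, the reference copy,
    exists even when there are no literals. *)
Definition bound : nat := (sumn (map size Cs)).+1.

Lemma size_bound C : List.In C Cs -> size C < bound.
Proof.
rewrite ltnS; elim: Cs => [|D Ds IH] //= [->|/IH]; first exact: leq_addr.
by move=> /leq_trans; apply; apply: leq_addl.
Qed.

Definition slots : seq (option 'I_m * nat) :=
  [seq (i, p) | i <- enum {: option 'I_m}, p <- iota 0 bound].

Lemma mem_slots i p : ((i, p) \in slots) = (p < bound).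
Proof.
apply/allpairsP/idP => [[[j q] [_ qb [_ ->]]]|pb].
  by move: qb; rewrite mem_iota.
by exists (i, p); rewrite mem_enum mem_iota.
Qed.

Lemma slots_uniq : uniq slots.
Proof. by apply: allpairs_uniq; rewrite ?enum_uniq ?iota_uniq // => -[? ?] [? ?]. Qed.

Definition slot_dep (ip : option 'I_m * nat) : seq var * var :=
  ([seq vW ip.2 l | l : 'I_(arity ip.1) <- enum 'I_(arity ip.1)], vY ip.1 ip.2).

Definition tr_deps : seq (seq var * var) := ([::], vS) :: map slot_dep slots.

Definition tr_clauses : seq (clause t) :=
  map main_clause Cs ++ map agree_clause slots ++
  rel_clause :: map point_clause (enum {: {ffun valuation -> 'I_(size Cs)}}).

Local Notation ys := (unzip2 tr_deps).

(** * Syntactic conditions on the translation *)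

Lemma ysE : ys = vS :: [seq vY ip.1 ip.2 | ip <- slots].
Proof. by rewrite /= /unzip2 -map_comp. Qed.

Lemma mem_ysP x : x \in ys -> x = vS \/ exists i p, x = vY i p.
Proof.
by rewrite ysE inE => /predU1P[->|/mapP[[i p] _ ->]]; [left|right; exists i, p].
Qed.

Lemma vY_ys i p : p < bound -> vY i p \in ys.
Proof.
by move=> pb; rewrite ysE inE; apply/orP; right; apply/mapP;
  exists (i, p); rewrite ?mem_slots.
Qed.

Lemma vS_ys : vS \in ys.
Proof. by rewrite ysE inE eqxx. Qed.

Lemma tr_ys_uniq : uniq ys.
Proof.
rewrite ysE /=; apply/andP; split.
  by apply/mapP => -[[i p] _ /enc_inj].
by rewrite map_inj_uniq ?slots_uniq // => -[i p] [j q] /enc_inj [-> ->].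
Qed.

Lemma tr_ys_z : {in ys, forall y, y \notin z}.
Proof. by move=> y /mem_ysP[->|[i [p ->]]]; apply: enc_z. Qed.

Lemma vX_ys x : vX x \notin ys.
Proof. by apply/negP => /mem_ysP[/enc_inj|[i [p /enc_inj]]]. Qed.

Lemma vW_ys p l : vW p l \notin ys.
Proof. by apply/negP => /mem_ysP[/enc_inj|[i [q /enc_inj]]]. Qed.

Lemma tr_deps_ys : {in tr_deps, forall d, ~~ has (fun w => w \in ys) d.1}.
Proof.
move=> d; rewrite inE => /predU1P[-> //|/mapP[ip _ ->]].
by apply/hasPn => _ /mapP[l _ ->]; apply: vW_ys.
Qed.

Lemma no_var_in (a : atom t) :
  (forall x, x \in avars a -> x \notin ys) -> has_var_in ys a = false.
Proof. by move=> H; apply/negbTE/hasPn. Qed.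

Lemma bd_atom_no_var (a : atom t) :
  (forall x, x \in avars a -> x \notin ys) -> bd_atom ys a.
Proof. by move=> /no_var_in H; rewrite /bd_atom H. Qed.

Lemma bd_atom_isZero x : x \in ys -> bd_atom ys (isZero x).
Proof. by move=> xy _; left; exists x. Qed.

Lemma bare_lit_avars sg l : avars (latom (bare_lit sg l)) = [::].
Proof.
suff H a : avars (bare_atom sg a) = [::] by case: l => a /=.
case: a => //= -[[r|r]|i] g //=; last by case: (sg i).
by elim: (enum _).
Qed.

(** A positive atom with an existential variable arises only as [y = 0] from a positive predicate
    literal: guards are negative, and renamed terms contain universal variables only. A positive [R]
    would produce such an atom too and is excluded. *)
Lemma count_tr_lit p l :
  ~~ pos_added l -> count (pos_with_var_in ys) (tr_lit p l) <= pos_quantified l.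
Proof.
have ren_ys u x : x \in tvars (rename u) -> x \notin ys.
  by move=> /tvars_rename[y ->]; apply: vX_ys.
case: l => [[| |u v|[[r|r]|i] g]|[| |u v|[[r|r]|i] g]] //= _;
  rewrite ?count_guarded //= ?addn0.
- rewrite no_var_in // => x; rewrite /= mem_cat => /orP[]; exact: ren_ys.
- rewrite no_var_in // => x /flatten_mapP[j _]; exact: ren_ys.
- by case: has_var_in.
Qed.

Lemma bd_tr_lit p l l' :
  p < bound -> List.In l' (tr_lit p l) -> bd_atom ys (latom l').
Proof.
move=> pb.
have ren_ys u x : x \in tvars (rename u) -> x \notin ys.
  by move=> /tvars_rename[y ->]; apply: vX_ys.
have predP sg i g : (forall a, latom (sg a) = a) ->
    List.In l' (@tr_pred sg i p g) -> bd_atom ys (latom l').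
  move=> sgE /In_guarded[->|[j ->]]; first by rewrite sgE; apply/bd_atom_isZero/vY_ys.
  apply: bd_atom_no_var => x /=; rewrite inE => /predU1P[->|]; first exact: vW_ys.
  exact: ren_ys.
have atomP sg a : (forall a, latom (sg a) = a) ->
    List.In l' (tr_atom sg p a) -> bd_atom ys (latom l').
  move=> sgE; case: a => [| |u v|[[r|r]|i] g] /=;
    try (by apply: predP); case=> // <-; rewrite sgE; apply: bd_atom_no_var => x //=.
    by rewrite mem_cat => /orP[]; apply: ren_ys.
  by move=> /flatten_mapP[j _]; apply: ren_ys.
by case: l => a; apply: atomP.
Qed.

Lemma count_main_clause C :
  ~~ has (@pos_added t k m ar) C -> count (@pos_quantified _ m ar) C <= 1 ->
  count (pos_with_var_in ys) (main_clause C) <= 1.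
Proof.
move=> noR; apply: leq_trans; rewrite /= no_var_in; last first.
  by move=> x; rewrite /= !inE => /orP[]/eqP->;
    apply/negP => /mem_ysP[/enc_inj|[i [p /enc_inj]]].
(* Listing [C] by positions matches each literal with its translated block. *)
rewrite add0n -[in leqRHS](mkseq_nth (Pos Bot) C) /mkseq count_map.
apply: count_flatten_le => p /In_mem; rewrite mem_iota add0n => /= pC.
apply: count_tr_lit; move: noR; rewrite -all_predC => /(all_nthP (Pos Bot)).
exact.
Qed.

Lemma tr_count C :
  (forall C, List.In C Cs -> ~~ has (@pos_added t k m ar) C) ->
  (forall C, List.In C Cs -> count (@pos_quantified _ m ar) C <= 1) ->
  List.In C tr_clauses -> count (pos_with_var_in ys) C <= 1.
Proof.
move=> noR horn /In_cat[|/In_cat[|[|]]].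
- by move=> /In_map[D DCs ->]; apply: count_main_clause; [exact: noR|exact: horn].
- by move=> /In_map[ip _ ->]; rewrite count_guarded leq_b1.
- by move=> <-; rewrite count_guarded leq_b1.
move=> /In_map[f _ ->] /=; rewrite add0n.
(* The bare literals have no variables, so each block contributes nothing; the zero count puts the
   bound into the form of [count_flatten_le]. *)
apply: leq_trans (_ : count xpred0 (enum {: valuation}) <= 1);
  last by rewrite count_pred0.
apply: count_flatten_le => sg _; rewrite count_map leqn0; apply/eqP.
rewrite -[RHS](count_pred0 (nth [::] Cs (f sg))); apply: eq_count => l /=.
case: l (bare_lit_avars sg l) => a //= aE.
by rewrite /has_var_in aE.
Qed.

Lemma tr_bd_atom C l :
  List.In C tr_clauses -> List.In l C -> bd_atom ys (latom l).
Proof.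
move=> /In_cat[|/In_cat[|[|]]].
- move=> /In_map[D DCs ->] /= [<-|/In_flatten[_ /In_map[p /In_mem + ->]]].
    apply: bd_atom_no_var => x; rewrite /= !inE.
    by move=> /orP[]/eqP->; apply/negP => /mem_ysP[/enc_inj|[i [p /enc_inj]]].
  rewrite mem_iota add0n /= => pD; apply: bd_tr_lit.
  exact: ltn_trans pD (size_bound DCs).
- move=> /In_map[[i p] /In_mem + ->] /In_guarded[->|[j ->]] /=; rewrite mem_slots => pb.
    by move=> _; right; exists (vY i p), (vY i 0); rewrite !vY_ys.
  by apply: bd_atom_no_var => x /=; rewrite !inE => /orP[]/eqP->; apply: vW_ys.
- move=> <- /In_guarded[->|[j ->]] /=; first by apply/bd_atom_isZero/vY_ys.
  apply: bd_atom_no_var => x /=; rewrite !inE => /orP[]/eqP->; first exact: vW_ys.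
  by apply/negP => /tr_ys_z; rewrite mem_tnth.
move=> /In_map[f _ ->] /= [<-|]; first by apply/bd_atom_isZero/vS_ys.
move=> /In_flatten[_ /In_map[sg _ ->] /In_map[l' _ ->]].
by apply: bd_atom_no_var => x; rewrite bare_lit_avars.
Qed.

(** The guards of [rel_clause] mention every entry of [z], so each is indeed free in the final
    formula. *)
Lemma tr_fv : {subset z <= fv (bd_matrix tr_deps tr_clauses)}.
Proof.
move=> x /tnthP[i ->]; apply: (@mem_fv_matrix_clause _ _ _ rel_clause).
  by apply/In_cat; right; apply/In_cat; right; left.
by apply: (@cvars_guarded _ _ _ _ i); rewrite inE.
Qed.

(** * Correctness of the translation *)

Section Semantics.
Variables (A : structure t) (Q : set ('I_k -> A)).
Hypothesis Q_nonempty : exists q, Q q.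

Let c0 : A := @ic t A (zero t).

Local Notation sentence_model P := (expand (A := expand_rel Q) P).

(** The Skolem form of the translation, with the team replaced by its relation. *)
Definition skolem_sat : Prop :=
  exists h : seq var * var -> seq A -> A, forall e : var -> A,
    Q (fun i => e (tnth z i)) ->
    {in tr_deps, forall d, e d.2 = h d (map e d.1)} ->
    forall C, List.In C tr_clauses -> cholds e C.

Definition sentence_sat : Prop :=
  exists P : forall i, set ('I_(ar i) -> A), forall s C,
    List.In C Cs -> @cholds _ (sentence_model P) s C.

(** The values for [vW p] that make the guards at the position of [l] true. The index is a natural
    number, as in [vW]; beyond the arity, or without a relation symbol, the value is a default. *)
Definition arg_value (s : var -> A) (l : literal voc) (j : nat) : A :=
  if latom l is Rel r g then
    if insub j is Some i then @teval voc A s (g i) else c0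
  else c0.

(** * Literals and their translations *)

Section Literals.
Variables (P : forall i, set ('I_(arity i) -> A)) (e : var -> A) (p : nat).
Let s x := e (vX x).
Hypothesis Y_P : forall i, e (vY i p) = c0 <-> P (i := i) (fun j => e (vW p j)).

(** The prescribed argument values falsify the negated guards, so the final literal holds. For a
    negated [R] it suffices that the extra predicate contains [R]. *)
Lemma tr_lit_sound l :
  ~~ pos_added l -> (forall q, Q q -> P (i := None) q) ->
  (forall j, e (vW p j) = arg_value s l j) ->
  cholds e (tr_lit p l) ->
  @lholds _ (sentence_model (fun i => P (i := Some i))) s l.
Proof.
move=> noR QP W.
have argE i (g : 'I_(arity i) -> term t) :
    (forall j, arg_value s l j =
       if insub j is Some j then teval s (g j) else c0) ->
    (fun j : 'I_(arity i) => e (vW p j)) = (fun j => teval s (g j)).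
  by move=> H; apply: funext => j; rewrite W H valK.
have predE sg i (g : 'I_(arity i) -> term t) :
    (forall j, arg_value s l j =
       if insub j is Some j then teval s (g j) else c0) ->
    cholds e (@tr_pred sg i p g) -> lholds e (sg (isZero (vY i p))).
  move=> /argE H /cholds_guarded; apply=> j; rewrite teval_rename.
  exact: (congr1 (fun f : 'I_(arity i) -> A => f j) H).
case: l noR W argE predE =>
    [[| |u v|[[r|r]|i] g]|[| |u v|[[r|r]|i] g]] //= _ W argE predE;
  rewrite /cholds ?List.Exists_cons ?List.Exists_nil /= ?teval_rename;
  try (by case).
- by case=> //; congr irel; apply: funext => j; rewrite teval_rename.
- by move=> /(predE (@Pos t) (Some i) g (fun=> erefl)) /Y_P; rewrite (argE (Some i) g).
- case=> // H G; apply: H; move: G.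
  by congr irel; apply: funext => j; rewrite teval_rename.
- move=> /(predE (@Neg t) None g (fun=> erefl)) H /QP G; apply: H; apply/Y_P.
  by rewrite (argE None g).
- move=> /(predE (@Neg t) (Some i) g (fun=> erefl)) H G; apply: H; apply/Y_P.
  by rewrite (argE (Some i) g).
Qed.

(** The arguments [vW p] are arbitrary here: either a guard equation fails and satisfies the clause,
    or they are the actual arguments. A negated [R] now needs the extra predicate to be contained in
    [R]. *)
Lemma tr_lit_complete l :
  (forall q, P (i := None) q -> Q q) -> ~~ pos_added l ->
  @lholds _ (sentence_model (fun i => P (i := Some i))) s l ->
  cholds e (tr_lit p l).
Proof.
move=> PQ noR.
have argE i (g : 'I_(arity i) -> term t) :
    (forall j : 'I_(arity i), e (vW p j) = teval e (rename (g j))) ->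
    (fun j : 'I_(arity i) => e (vW p j)) = (fun j => teval s (g j)).
  by move=> H; apply: funext => j; rewrite H teval_rename.
case: l noR => [[| |u v|[[r|r]|i] g]|[| |u v|[[r|r]|i] g]] //= _;
  rewrite /cholds ?List.Exists_cons ?List.Exists_nil /= ?teval_rename;
  try (by left).
- by left; congr irel: H; apply: funext => j; rewrite teval_rename.
- by move=> H; apply/cholds_guarded => /(argE (Some i)) E; apply/Y_P; rewrite E.
- move=> H; left => G; apply: H; move: G.
  by congr irel; apply: funext => j; rewrite teval_rename.
- by move=> H; apply/cholds_guarded => /(argE None) E /Y_P; rewrite E => /PQ.
- by move=> H; apply/cholds_guarded => /(argE (Some i)) E /Y_P; rewrite E.
Qed.

End Literals.

(** * Structures with one element *)

Section Point.
Hypothesis point : forall a : A, a = c0.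

Lemma pointE (T : Type) (f g : T -> A) : f = g.
Proof. by apply: funext => x; rewrite (point (f x)) (point (g x)). Qed.

(** All tuples of a given length coincide, so a relation is full once it is nonempty, and the
    assignment does not affect the literal. *)
Lemma bare_litP (P : forall i, set ('I_(ar i) -> A)) (sg : 'I_m -> bool)
    (e s : var -> A) l :
  (forall i, sg i = `[< exists a, P i a >]) ->
  lholds e (bare_lit sg l) <-> @lholds _ (sentence_model P) s l.
Proof.
move=> sgE.
suff H a : aholds e (bare_atom sg a) <-> @aholds _ (sentence_model P) s a.
  by case: l => a /=; rewrite H.
case: a => [| |u v|[[r|r]|i] g] //=.
- by split=> // _; rewrite (point (teval _ u)) (point (teval _ v)).
- by rewrite (pointE (fun i => teval e term0) (fun i => teval s (g i))).
- by split=> // _; case: Q_nonempty => q; rewrite (pointE q (fun i => teval s (g i))).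
- rewrite sgE; case: asboolP => [[a Pa]|H] /=.
    by rewrite -(pointE a (fun i => teval s (g i))).
  by split=> // Pa; apply: H; exists (fun i => teval s (g i)).
Qed.

Lemma skolem_sat_point : skolem_sat -> sentence_sat.
Proof.
move=> [h H]; pose e (x : var) := c0.
have {}H f : cholds e (point_clause f).
  apply: (H e).
  - by case: Q_nonempty => q Qq; rewrite (pointE (fun i => e (tnth z i)) q).
  - by move=> d _; rewrite [RHS]point.
  - apply/In_cat; right; apply/In_cat; right; right.
    by apply/In_map; exists f => //; apply/In_mem; rewrite mem_enum.
have [sg sgP] : exists sg : valuation, forall C, List.In C Cs ->
    cholds e (map (bare_lit sg) C).
  (* If every valuation refuted some clause, choosing one for each would define an [f] whose point
     clause is false, its first literal failing because [vS] has value 0. *)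
  apply: contrapT => /forallNP no.
  have {no} bad (sg : valuation) : exists n : 'I_(size Cs),
      ~ cholds e (map (bare_lit sg) (nth [::] Cs n)).
    apply: contrapT => /forallNP all_; apply: (no sg) => C /(@List.In_nth _ _ _ [::]).
    case=> n [/ltP nC <-]; have := all_ (Ordinal (nC : n < size Cs)).
    by move=> /contrapT /=; congr (cholds _ (map _ _));
      elim: Cs n {nC} => [|D Ds IH] [|n] /=.
  pose f := [ffun sg => projT1 (cid (bad sg))].
  have /Exists_In[l []] := H f; first by move=> <- /=; apply.
  move=> /In_flatten[_ /In_map[sg _ ->] lC] hl.
  have := projT2 (cid (bad sg)); apply; apply/Exists_In; exists l => //.
  by move: lC; rewrite /f ffunE.
exists (fun i => [set _ | sg i]) => s C /sgP /Exists_In[_ /In_map[l lC ->]] hl.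
have sgE i : sg i = `[< exists a : 'I_(ar i) -> A, [set _ | sg i] a >].
  by apply/idP/asboolP => [sgi|[a]//]; exists (fun=> c0).
by apply/Exists_In; exists l => //; exact/(bare_litP e s l sgE).
Qed.

(** Every equation holds, so all clauses but the point clauses contain a true positive equation. *)
Lemma sentence_sat_point : sentence_sat -> skolem_sat.
Proof.
move=> [P H]; exists (fun _ _ => c0) => e _ _ C /In_cat[|/In_cat[|[|]]].
- by move=> /In_map[D _ ->]; left=> /=; rewrite [RHS]point.
- by move=> /In_map[ip _ ->]; apply/cholds_guarded => _ /=; rewrite [RHS]point.
- by move=> <-; apply/cholds_guarded => _ /=; rewrite [LHS]point.
move=> /In_map[f _ ->]; right.
(* Under the valuation of the given predicates all clauses hold, in particular the one that [f]
   selects for it. *)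
pose sg : valuation := [ffun i => `[< exists a, P i a >]].
have fC : List.In (nth [::] Cs (f sg)) Cs.
  by elim: Cs (f sg : nat) (ltn_ord (f sg))
    => [|D Ds IH] [|n] //= nD; [left|right; exact: IH].
have /Exists_In[l lC hl] := H e _ fC.
apply/Exists_In; exists (bare_lit sg l).
  apply/In_flatten; exists (map (bare_lit sg) (nth [::] Cs (f sg)));
    last by apply/In_map; exists l.
  by apply/In_map; exists sg => //; apply/In_mem; rewrite mem_enum.
have sgE i : sg i = `[< exists a, P i a >] by rewrite ffunE.
exact/(bare_litP e e l sgE).
Qed.

End Point.

(** * Structures with at least two elements *)

Section NonPoint.
Variable b : A.
Hypothesis b_c0 : b <> c0.
Hypothesis no_pos_R : forall C, List.In C Cs -> ~~ has (@pos_added t k m ar) C.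

Lemma no_pos_R_nth C p : List.In C Cs -> ~~ pos_added (nth (Pos Bot) C p).
Proof.
move=> /no_pos_R; rewrite -all_predC => /(all_nthP (Pos Bot)) H.
by have [/H //|pC] := ltnP p (size C); rewrite nth_default.
Qed.

Hypothesis z_uniq : uniq z.

(** The codes are distinct and avoid [z], so the universal variables can be given any values, and
    [vU], [vV] different ones. *)
Lemma environment_exists (h : seq var * var -> seq A -> A) q s w :
  exists e : var -> A,
  [/\ (fun i => e (tnth z i)) = q,
      {in tr_deps, forall d, e d.2 = h d (map e d.1)},
      forall x, e (vX x) = s x,
      forall p l, e (vW p l) = w p l
    & e vU <> e vV].
Proof.
(* The existential variables are computed from [w] directly, which avoids a circular definition of
   [e]. *)
pose decoded x := match dec x with
  | Some (inl (inl (inl x))) => s x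
  | Some (inl (inl (inr (p, l)))) => w p l
  | Some (inl (inr ip)) =>
    h (slot_dep ip) [seq w ip.2 l | l : 'I_(arity ip.1) <- enum 'I_(arity ip.1)]
  | Some (inr None) => h ([::], vS) [::]
  | Some (inr (Some u)) => if u then c0 else b
  | None => c0
  end.
(* Outside [z] the index is [k], so [insub] fails and the decoded value is taken. *)
pose e x := if insub (index x z) is Some i then q i else decoded x.
have e_enc c : e (enc c) = decoded (enc c).
  by rewrite /e insubF // -[X in _ < X](size_tuple z) index_mem (negbTE (enc_z c)).
exists e; split=> [|d|x|p l|].
- apply: funext => i.
  by rewrite /e (tnth_nth 0) index_uniq ?size_tuple // valK.
- rewrite inE => /predU1P[->|/mapP[ip _ ->]] /=; rewrite e_enc /decoded encK //.
  by congr h; rewrite -map_comp; apply: eq_map => l /=; rewrite e_enc /decoded encK.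
- by rewrite e_enc /decoded encK.
- by rewrite e_enc /decoded encK.
- by rewrite !e_enc /decoded !encK => /esym.
Qed.

(** Each predicate is read as the zero set of its Skolem function at slot 0. Every clause is used in
    an environment that makes its guards true. *)
Lemma sentence_sat_of_skolem : skolem_sat -> sentence_sat.
Proof.
move=> [h H].
have {}H q s w : Q q -> exists e : var -> A,
    [/\ forall C, List.In C tr_clauses -> cholds e C,
        (fun i => e (tnth z i)) = q, (fun x => e (vX x)) = s /\ e vU <> e vV,
        forall p l, e (vW p l) = w p l
      & forall i p, p < bound -> e (vY i p) =
          h (slot_dep (i, p)) [seq w p l | l : 'I_(arity i) <- enum 'I_(arity i)]].
  move=> Qq; have [e [ez ed eX eW eUV]] := environment_exists h q s w; exists e.
  split=> //; [|by split=> //; apply: funext|].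
    by apply: H => //; rewrite ez.
  move=> i p pb; rewrite (ed (slot_dep (i, p))); last first.
    by rewrite inE map_f ?mem_slots // orbT.
  by congr h; rewrite -map_comp; apply: eq_map => l /=; rewrite eW.
pose fn i p (a : 'I_(arity i) -> A) :=
  h (slot_dep (i, p)) [seq a l | l <- enum 'I_(arity i)].
pose P i (a : 'I_(arity i) -> A) := fn i 0 a = c0.
pose ext i (a : 'I_(arity i) -> A) j := if insub j is Some j then a j else c0.
have extE i a (j : 'I_(arity i)) : ext i a j = a j by rewrite /ext valK.
have [q0 Qq0] := Q_nonempty.
(* With the same tuple at slots [p] and 0, the agreement clause equates the two copies at that
   tuple. *)
have agree i p a : p < bound -> fn i p a = fn i 0 a.
  move=> pb; have [e [eC _ _ eW eY]] := H q0 (fun=> c0) (fun=> ext i a) Qq0.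
  have /cholds_guarded /= : cholds e (agree_clause (i, p)).
    apply: eC; apply/In_cat; right; apply/In_cat; left.
    by apply/In_map; exists (i, p) => //; apply/In_mem; rewrite mem_slots.
  rewrite !eY // !(eq_map (extE i a)); apply=> j.
  by rewrite !eW.
have QP q : Q q -> P None q.
  move=> Qq; have [e [eC ez _ eW eY]] := H q (fun=> c0) (fun=> ext None q) Qq.
  have /cholds_guarded /= : cholds e rel_clause.
    by apply: eC; apply/In_cat; right; apply/In_cat; right; left.
  rewrite eY // (eq_map (extE None q)); apply=> j.
  by rewrite eW (extE None) -[in LHS]ez.
exists (fun i => P (Some i)) => s C CCs.
pose w p := arg_value s (nth (Pos Bot) C p).
have [e [eC _ [eX eUV] eW eY]] := H q0 s w Qq0.
have /Exists_In[l []] : cholds e (main_clause C).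
  by apply: eC; apply/In_cat; left; apply/In_map; exists C.
  (* The escape literal [u = v] is false in the chosen environment. *)
  by move=> <-.
move=> /In_flatten[_ /In_map[p /In_mem + ->] lC] hl.
rewrite mem_iota add0n => /= pC.
apply/Exists_In; exists (nth (Pos Bot) C p).
  by elim: {+}C p pC {lC} => [|l' D IH] [|p] //= pD; [left|right; exact: IH].
rewrite -eX; apply: (@tr_lit_sound P e p) => //.
- have pb := ltn_trans pC (size_bound CCs).
  move=> i; rewrite eY // /P -(agree i p) //.
  by have -> : (fun j : 'I_(arity i) => e (vW p j)) = (fun j => w p j) by
    apply: funext => j; rewrite eW.
- exact: no_pos_R_nth.
- by move=> j; rewrite eW eX.
- by apply/Exists_In; exists l.
Qed.

(** Each predicate gets a characteristic function with value 0 inside and [b] outside; [R] itself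
    serves as its own superset. *)
Lemma skolem_sat_of_sentence : sentence_sat -> skolem_sat.
Proof.
move=> [P H].
pose P' (i : option 'I_m) : set ('I_(arity i) -> A) :=
  match i return set ('I_(arity i) -> A) with Some i => P i | None => Q end.
(* The predicate is recognised from the variable [d.2], and all its copies get the same function. As
   [vS] is no [vY], it gets [b], which makes the first literal of every point clause true. *)
pose true_at (d : seq var * var) ws := exists i p (a : 'I_(arity i) -> A),
  [/\ d.2 = vY i p, ws = [seq a l | l <- enum 'I_(arity i)] & P' i a].
exists (fun d ws => if `[< true_at d ws >] then c0 else b) => e Qe deps_e.
have eY i p : p < bound ->
    e (vY i p) = if `[< P' i (fun l => e (vW p l)) >] then c0 else b.
  move=> pb; have := deps_e (slot_dep (i, p)).
  rewrite inE map_f ?mem_slots // orbT => /(_ isT) /= ->.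
  congr (if _ then _ else _); apply/asboolP/asboolP; last first.
    by move=> Pa; exists i, p, (fun l => e (vW p l)); split=> //; rewrite -map_comp.
  move=> [j [r [a [/= /enc_inj [ij _] + Pa]]]]; subst j.
  rewrite -map_comp => /eq_in_map E; suff <- : a = (fun l => e (vW p l)) by [].
  by apply: funext => l; rewrite -E ?mem_enum.
have eP i p : p < bound -> e (vY i p) = c0 <-> P' i (fun l => e (vW p l)).
  by move=> /eY ->; case: asboolP.
have eS : e vS = b.
  have /= -> := deps_e ([::], vS) (mem_head _ _).
  by case: asboolP => // -[i [p [a [/= /enc_inj]]]].
move=> C /In_cat[|/In_cat[|[|]]].
- move=> /In_map[D DCs ->]; right.
  have /Exists_In[l /(@List.In_nth _ _ _ (Pos Bot))[p [/ltP pD <-]] hl] :=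
    H (fun x => e (vX x)) D DCs.
  have /Exists_In[l' l'p hl'] : cholds e (tr_lit p (nth (Pos Bot) D p)).
    apply: (@tr_lit_complete P') => //.
    - by move=> i; apply: eP; rewrite (ltn_trans _ (size_bound DCs)).
    - exact: no_pos_R_nth.
    - by congr lholds: hl; elim: {+}D p {pD} => [|? ? IH] [|p] /=.
  apply/Exists_In; exists l' => //; apply/In_flatten.
  exists (tr_lit p (nth (Pos Bot) D p)) => //.
  by apply/In_map; exists p => //; apply/In_mem; rewrite mem_iota.
- move=> /In_map[[i p] /In_mem + ->]; rewrite mem_slots => pb.
  apply/cholds_guarded => /= W; rewrite !eY //.
  by congr (if `[< P' _ _ >] then _ else _); apply: funext.
- move=> <-; apply/cholds_guarded => /= W; apply/eP => //=.
  by congr Q: Qe; apply: funext.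
- by move=> /In_map[f _ ->]; left=> /=; rewrite eS.
Qed.

End NonPoint.

Lemma skolem_sentence_sat :
  uniq z -> (forall C, List.In C Cs -> ~~ has (@pos_added t k m ar) C) ->
  skolem_sat <-> sentence_sat.
Proof.
move=> z_uniq noR; case: (EM (forall a : A, a = c0)) => [point|/existsNP[b bc]].
  by split; [exact: skolem_sat_point|exact: sentence_sat_point].
by split; [exact: (sentence_sat_of_skolem bc)|exact: (skolem_sat_of_sentence bc)].
Qed.

End Semantics.
End Translation.

(** * The equivalence for teams *)

Theorem theorem5p5 (t : succ_vocabulary) (k : nat) (z : k.-tuple nat)
    (z_uniq : uniq z) (psi : eso (add_rel t k))
    (psi_horn : eso_horn_sentence psi) (R_neg : only_negative psi) :
  exists phi : form t,
    [/\ bd_horn phi,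
        fv phi =i z
      & forall (A : structure t) (X : team A),
          team_dom z X -> nonempty X ->
          (tsat X phi <-> eso_holds (expand_rel (team_rel z X)) psi)].
Proof.
case: psi psi_horn R_neg => m ar xs Cs /andP[_ /all_In /= horn] /all_In /= noR.
exists (bd_closure z (tr_deps z Cs) (tr_clauses z Cs)); split.
- apply: bd_horn_closure.
  + exact: tr_ys_uniq.
  + exact: tr_deps_ys.
  + by move=> C; apply: tr_count.
  + by move=> C l; apply: tr_bd_atom.
- by apply: fv_closure; [exact: tr_ys_z|exact: tr_fv].
move=> A X Xz [s0 Xs0].
have total_z s i : X s -> s (tnth z i) = Some (total s (tnth z i)).
  move=> Xs; have := Xz s Xs (tnth z i); rewrite mem_tnth /Defs.total.
  by case: (s _).
have Q0 : exists q, team_rel z X q.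
  by exists (fun i => total s0 (tnth z i)), s0 => // i; apply: total_z.
rewrite tsat_closure //; [|exact: tr_ys_uniq|exact: tr_ys_z|exact: tr_deps_ys].
(* The Skolem form sees a team member only through its values on [z], that is, through a tuple of
   the relation. *)
apply: (iff_trans (B := skolem_sat z Cs (team_rel z X))).
  split=> -[h H]; exists h.
    move=> e [s Xs sE]; apply: H Xs _ => x /tnthP[i ->].
    by rewrite /Defs.total sE.
  move=> s e Xs es; apply: H; exists s => // i.
  by rewrite total_z // es ?mem_tnth.
rewrite skolem_sentence_sat //; split=> -[P H]; exists P => s.
  by apply/List.Forall_forall => C; apply: H.
by move=> C CCs; have /List.Forall_forall := H s; apply.
Qed.
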